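(* Let $T$ be a tree with at least two vertices and let $g$ be an eigenfunction of $\lambda_1$, the second smallest eigenvalue of the normalized Laplacian matrix $\mathcal{L}(T)$. Let $v$ be a vertex of $T$. Then $T$ is a Type 1 tree with characteristic vertex $v$ if and only if there are at least two Perron branches at $v$. In this case, $\lambda_1=\dfrac{1}{\rho(\mathcal{L}(C)^{-1})}$ for each Perron branch $C$ at $v$.
   Context: For a tree $T$ on $n\ge 2$ vertices, $d_u$ is the degree of $u$ in $T$, and the normalized Laplacian matrix is the $n\times n$ matrix $\mathcal{L}=\mathcal{L}(T)$ with entries $\mathcal{L}(u,u)=1$, $\mathcal{L}(u,w)=-1/\sqrt{d_u d_w}$ if $u,w$ are adjacent, and $0$ otherwise. Its eigenvalues are $0=\lambda_0\le\lambda_1\le\dots\le\lambda_{n-1}$; an eigenfunction of $\lambda$ is a nonzero real vector $g$ indexed by the vertices with $\mathcal{L}g=\lambda g$. $\rho$ denotes the spectral radius. Type 1 (with respect to the eigenfunction $g$ of $\lambda_1$): no block of $T$ is mixed, where the blocks of a tree are its edges (pairs of adjacent vertices) and a block is mixed if $g$ is positive at one of its vertices and negative at another. In that case there is a unique vertex $z$ with $g(z)=0$ that is adjacent to a vertex where $g$ is nonzero; it is called the characteristic vertex of $T$. A branch of $T$ at a vertex $k$ is a connected component of $T-k$, the graph obtained from $T$ by deleting $k$ and its edges. Let $\mathcal{L}_k$ be the principal submatrix of $\mathcal{L}$ obtained by deleting the row and column of $k$. For a branch $C$ at $k$, $\mathcal{L}(C)$ is the principal submatrix of $\mathcal{L}$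 indexed by the vertices of $C$ (degrees are taken in $T$), and the normalized bottleneck matrix of $C$ at $k$ is the diagonal block of $\mathcal{L}_k^{-1}$ corresponding to $C$, i.e. $\mathcal{L}(C)^{-1}$. A branch $C$ at $k$ is a Perron branch at $k$ if $\rho(\mathcal{L}(C)^{-1})$ is largest among all branches at $k$ (several branches may attain the maximum). *)

(* Defs.v *)
From HB Require Import structures.
From mathcomp Require Import all_boot all_order all_algebra.
From mathcomp Require Import complex.

Set Implicit Arguments.
Unset Strict Implicit.
Unset Printing Implicit Defensive.

Import Order.TTheory GRing.Theory Num.Theory.
Local Open Scope ring_scope.

Record is_tree (V : finType) (e : rel V) : Prop := IsTree {
  tree_sym : symmetric e;
  tree_irr : irreflexive e;
  tree_connected : forall u w : V, connect e u w;
  (* a closed walk [:: u; w] of length 2 is not a cycle *)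
  tree_acyclic : forall c : seq V, ucycle e c -> (size c <= 2)%N
}.

Definition del_vertex (V : finType) (e : rel V) (k : V) : rel V :=
  [rel u w | [&& u != k, w != k & e u w]].

Definition branches (V : finType) (e : rel V) (k : V) : {set {set V}} :=
  equivalence_partition (connect (del_vertex e k)) [set~ k].

Section Spectrum.
Variables (R : rcfType) (n : nat).
Implicit Type A : 'M[R]_n.

(* The complex roots of the characteristic polynomial, with multiplicity, in
   an unspecified order. *)
Definition spectrum A : seq R[i] :=
  sval (closed_field_poly_normal (char_poly (map_mx (real_complex R) A))).

(* Meant for symmetric matrices, whose eigenvalues are real: there, taking the
   real part only moves the eigenvalues from R[i] back to R. *)
Definition sorted_eigenvalues A : seq R :=
  sort <=%R [seq complex.Re z | z <- spectrum A].

Definition spectral_radius A : R :=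
  \big[Num.max/0]_(z <- spectrum A) ComplexField.Normc.normc z.

Definition is_eigenfunction A (lambda : R) (g : 'cV[R]_n) : Prop :=
  g != 0 /\ A *m g = lambda *: g.

Definition principal_submx A (C : {set 'I_n}) : 'M[R]_#|C| :=
  \matrix_(i, j) A (enum_val i) (enum_val j).

End Spectrum.

Section NormalizedLaplacian.
Variables (R : rcfType) (n : nat) (e : rel 'I_n).

Definition degree (u : 'I_n) : nat := #|[set w | e u w]|.

Definition norm_laplacian : 'M[R]_n := \matrix_(u, w)
  if u == w then 1
  else if e u w then - (1 / Num.sqrt ((degree u)%:R * (degree w)%:R))
  else 0.

Definition lambda1 : R := (sorted_eigenvalues norm_laplacian)`_1.

Definition mixed_block (g : 'cV[R]_n) (u w : 'I_n) : Prop :=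
  (0 < g u 0 /\ g w 0 < 0) \/ (g u 0 < 0 /\ 0 < g w 0).

Definition type1 (g : 'cV[R]_n) : Prop :=
  forall u w : 'I_n, e u w -> ~ mixed_block g u w.

(* On a Type 1 tree exactly one vertex has this property. *)
Definition is_characteristic_vertex (g : 'cV[R]_n) (z : 'I_n) : Prop :=
  g z 0 = 0 /\ exists2 w : 'I_n, e z w & g w 0 != 0.

Definition bottleneck (C : {set 'I_n}) : 'M[R]_#|C| :=
  invmx (principal_submx norm_laplacian C).

Definition perron_branches (k : 'I_n) : {set {set 'I_n}} :=
  [set C in branches e k | [forall D in branches e k,
     spectral_radius (bottleneck D) <= spectral_radius (bottleneck C)]].

End NormalizedLaplacian.

Arguments norm_laplacian R {n} e.
Arguments lambda1 R {n} e.
Arguments bottleneck R {n} e C.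
Arguments perron_branches R {n} e k.

(* Main.v *)
Require Import Defs.
From mathcomp Require Import all_boot all_order all_algebra.
From mathcomp Require Import complex ring lra.
Import Order.TTheory GRing.Theory Num.Theory.
Local Open Scope ring_scope.

(** Write $L$ for the normalized Laplacian, $s$ for the vector of the
$\sqrt{d_u}$, $\langle x, y\rangle$ for the dot product, and, for a branch
$C$ at $v$, $\mu(C) = 1/\rho(\mathcal{L}(C)^{-1})$. The form of $L$ is half
the sum of $(x_u/\sqrt{d_u} - x_w/\sqrt{d_w})^2$ over ordered pairs of
adjacent vertices, so it is nonnegative and, the tree being connected, vanishes
only on the line of $s$. Hence $\mathcal{L}(C)$ is positive definite, $\mu(C)$
is its least eigenvalue, and the Perron branches are those that minimize $\mu$
([branch_bottom], [perron_branchP]). Likewise $\lambda_1 > 0$, and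
$\lambda_1\langle x, x\rangle \le \langle x, Lx\rangle$ for all
$x \perp s$ ([lambda1_gap]).

Replacing a minimizer of the Rayleigh quotient on $C$ by its absolute value
gives another one, and a nonnegative minimizer cannot vanish anywhere on the
connected set $C$. So there is an eigenvector for $\mu(C)$ that is positive on
$C$, and no eigenvector for $\mu(C)$ changes sign along an edge
([perron_vector], [perron_sign]).

The comparison that drives both directions is [two_branch_bound]. For distinct
branches $C$, $D$, the combination of their Perron vectors that is orthogonal
to $s$ has a Rayleigh quotient which is a weighted mean, with positive weights,
of $\mu(C)$ and $\mu(D)$; as it is at least $\lambda_1$, one cannot have
$\mu(C) < \lambda_1$ and $\mu(D) \le \lambda_1$.

If $v$ is a characteristic vertex, then row $v$ of $Lg = \lambda_1 g$ forces
$g$ to take both signs on the neighbours of $v$. In a tree these lie in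
different branches $C$, $D$. Since $g(v) = 0$, the restrictions of $g$ to $C$
and $D$ are eigenvectors for $\lambda_1$, so $\mu(C), \mu(D) \le \lambda_1$.
The comparison turns these into equalities and shows that $\mu$ is nowhere
below $\lambda_1$: both branches are Perron branches, and $\mu = \lambda_1$
on every Perron branch ([characteristic_vertex_branches]).

Conversely, if $C \ne D$ are Perron branches, the comparison gives
$\lambda_1 \le \mu(C)$. Suppose $g(v) > 0$. Pairing $Lg = \lambda_1 g$ with
the Perron vector of $C$ shows that the inequality is strict. Then the negative
part of $g$ on each branch has a Rayleigh quotient at most
$\lambda_1 < \mu$, so it is zero and $g \ge 0$, which contradicts
$g \perp s$. Hence $g(v) = 0$ ([eigen_center0]). Now the restriction of $g$ to
a branch is zero or an eigenvector for the least eigenvalue of that branch;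
such an eigenvector has constant sign and no zero, so there is no mixed block,
and $g$ is nonzero at the neighbour of $v$ in a branch where $g$ is not zero. *)

Set Implicit Arguments.
Unset Strict Implicit.
Unset Printing Implicit Defensive.

(** * The dot product *)

Section Dot.
Variable R : rcfType.

Definition dot n (x y : 'cV[R]_n) : R := \sum_i x i 0 * y i 0.

Lemma dotE n (x y : 'cV[R]_n) : dot x y = (x^T *m y) 0 0.
Proof. by rewrite mxE; apply: eq_bigr => i _; rewrite mxE. Qed.

Lemma dotC n (x y : 'cV[R]_n) : dot x y = dot y x.
Proof. by apply: eq_bigr => i _; rewrite mulrC. Qed.

Lemma dotDr n (x y z : 'cV[R]_n) : dot x (y + z) = dot x y + dot x z.
Proof. by rewrite -big_split; apply: eq_bigr => i _; rewrite mxE mulrDr. Qed.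

Lemma dotZr n a (x y : 'cV[R]_n) : dot x (a *: y) = a * dot x y.
Proof. by rewrite mulr_sumr; apply: eq_bigr => i _; rewrite mxE mulrCA. Qed.

Lemma dotDl n (x y z : 'cV[R]_n) : dot (x + y) z = dot x z + dot y z.
Proof. by rewrite dotC dotDr !(dotC z). Qed.

Lemma dotZl n a (x y : 'cV[R]_n) : dot (a *: x) y = a * dot x y.
Proof. by rewrite dotC dotZr dotC. Qed.

Lemma dot_mull m n (A : 'M[R]_(m, n)) x y : dot (A *m x) y = dot x (A^T *m y).
Proof. by rewrite !dotE trmx_mul mulmxA. Qed.

Lemma dot_ge0 n (x : 'cV[R]_n) : 0 <= dot x x.
Proof. by apply: sumr_ge0 => i _; rewrite -expr2 sqr_ge0. Qed.

Lemma dot_eq0 n (x : 'cV[R]_n) : (dot x x == 0) = (x == 0).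
Proof.
apply/eqP/eqP => [/eqP|->]; last by apply: big1 => i _; rewrite mxE mul0r.
rewrite psumr_eq0 => [/allP x0|i _]; last by rewrite -expr2 sqr_ge0.
apply/matrixP => i j; rewrite ord1 mxE; apply/eqP.
by have := x0 i (mem_index_enum _); rewrite mulf_eq0 orbb.
Qed.

Lemma dot_gt0 n (x : 'cV[R]_n) : (0 < dot x x) = (x != 0).
Proof. by rewrite lt0r dot_eq0 dot_ge0 andbT. Qed.

End Dot.

(** * Eigenvalues of real symmetric matrices *)

Section Spectral.
Variable R : rcfType.
Local Notation toC := (real_complex R).
Local Notation "M ^R" := (map_mx toC M) (at level 1, format "M ^R").
Local Notation "M ^H" := (map_mx (Num.conj : R[i] -> R[i]) M^T)
  (at level 1, format "M ^H").

Lemma char_poly_conj (F : fieldType) n (P D : 'M[F]_n) : P \in unitmx ->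
  char_poly (invmx P *m D *m P) = char_poly D.
Proof.
move=> uP; rewrite /char_poly /char_poly_mx.
have -> : 'X%:M - map_mx polyC (invmx P *m D *m P) =
   map_mx polyC (invmx P) *m ('X%:M - map_mx polyC D) *m map_mx polyC P.
  rewrite mulmxBr mulmxBl -!map_mxM /=; congr (_ - _).
  by rewrite scalar_mxC -mulmxA -map_mxM mulVmx // map_mx1 mulmx1.
by rewrite !det_mulmx mulrAC -det_mulmx -map_mxM mulVmx // map_mx1 det1 mul1r.
Qed.

(** The complex spectral theorem for Hermitian matrices, with the diagonal
brought back to the real field. The eigenbasis (the rows of $P$, conjugated)
stays complex. *)
Lemma symmetric_spectral n (A : 'M[R]_n) : A^T = A ->
  exists (P : 'M[R[i]]_n) (d : 'rV[R]_n),
    P *m P^H = 1%:M /\ P *m A^R = diag_mx d^R *m P.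
Proof.
move=> symA.
have hA : A^R \is hermsymmx.
  apply: realsym_hermsym.
    by apply/is_hermitianmxP; rewrite expr0 scale1r map_mx_id // map_trmx symA.
  by apply/mxOverP => i j; rewrite mxE; apply/complex_realP; exists (A i j).
have uP := spectral_unitarymx A^R.
have /hermitian_normalmx/orthomx_spectralP defA := hA.
have dr := hermitian_spectral_diag_real hA.
exists (spectralmx A^R), (map_mx (@complex.Re R) (spectral_diag A^R)).
split; first exact/unitarymxP.
rewrite {2}defA -mulmxA mulKVmx ?spectral_unit //; congr (diag_mx _ *m _).
by apply/matrixP => i j; rewrite !mxE RRe_real //; have /mxOverP := dr.
Qed.

(** The equation $PA = DP$ gives the eigenvalues with their multiplicities,
because it makes the characteristic polynomial of $A$ that of $D$. *)
Lemma spectrum_diag n (A : 'M[R]_n) (P : 'M[R[i]]_n) (d : 'rV[R]_n) :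
  P *m P^H = 1%:M -> P *m A^R = diag_mx d^R *m P ->
  perm_eq (spectrum A) [seq toC (d 0 i) | i : 'I_n].
Proof.
move=> PP PA; have uP : P \in unitmx by case: (mulmx1_unit PP).
rewrite /spectrum; case: closed_field_poly_normal => /= s.
have -> : A^R = invmx P *m diag_mx d^R *m P by rewrite -mulmxA -PA mulKmx.
rewrite char_poly_conj // (monicP (char_poly_monic _)) scale1r => defs.
apply: prod_XsubC_eq; rewrite -defs char_poly_trig ?diag_mx_is_trig //.
rewrite big_map big_enum; apply: eq_bigr => i _.
by rewrite !mxE eqxx mulr1n.
Qed.

Section Diagonalized.
Variables (n : nat) (A : 'M[R]_n) (P : 'M[R[i]]_n) (d : 'rV[R]_n).
Hypotheses (PP : P *m P^H = 1%:M) (PA : P *m A^R = diag_mx d^R *m P).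

(** A complex eigenvector for a real eigenvalue of a real matrix is enough: the
singularity of $A - d_i$ does not depend on the field. *)
Lemma diag_real_eigenvector i : A^T = A ->
  exists2 x : 'cV[R]_n, x != 0 & A *m x = d 0 i *: x.
Proof.
move=> symA; have: eigenvalue A^R (toC (d 0 i)).
  apply/eigenvalueP; exists (row i P).
    by rewrite -row_mul PA row_mul row_diag_mx -scalemxAl -rowE mxE.
  apply/eqP => Pi0; have /matrixP/(_ i i)/eqP := PP.
  rewrite mxE big1 ?mxE ?eqxx 1?eq_sym ?oner_eq0 // => k _.
  by have /matrixP/(_ 0 k) := Pi0; rewrite !mxE => ->; rewrite mul0r.
rewrite eigenvalue_map => /eigenvalueP[v vA v0]; exists v^T.
  by rewrite trmx_eq0.
by rewrite -{1}symA -trmx_mul vA linearZ.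
Qed.

(** Parseval's identity in the orthonormal basis given by the rows of $P$. *)
Lemma dot_spectral x y : toC (dot x y) =
  \sum_i Num.conj ((P *m x^R) i 0) * (P *m y^R) i 0.
Proof.
have PP' : P^H *m P = 1%:M by apply: mulmx1C.
have -> : toC (dot x y) = ((x^R)^T *m y^R) 0 0.
  by rewrite map_trmx -map_mxM mxE dotE.
have <- : (P *m x^R)^H *m (P *m y^R) = (x^R)^T *m y^R.
  rewrite trmx_mul map_mxM mulmxA -(mulmxA _ _ P) PP' mulmx1; congr (_ *m _).
  by apply/matrixP => i j; rewrite !mxE; apply: conjc_real.
by rewrite mxE; apply: eq_bigr => i _; rewrite 2!mxE.
Qed.

(** Only the eigenvalues whose coordinate of $x$ is nonzero matter: this allows
one to discard the kernel for $x$ orthogonal to it. *)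
Lemma rayleigh_spectral r x :
  (forall i, (P *m x^R) i 0 != 0 -> r <= d 0 i) ->
  r * dot x x <= dot x (A *m x).
Proof.
move=> rd; rewrite -lecR rmorphM /= !dot_spectral mulr_sumr.
apply: ler_sum => i _; rewrite map_mxM mulmxA PA -mulmxA.
have := rd i; move: (P *m x^R) => z zr.
rewrite mul_diag_mx [X in _ <= _ * X]mxE [d^R _ _]mxE [leRHS]mulrCA.
have [->|/zr ri] := eqVneq (z i 0) 0; first by rewrite !mulr0.
by apply: ler_wpM2r; rewrite ?lecR // mulrC mul_conjC_ge0.
Qed.

End Diagonalized.

(** For positive definite $A$ the eigenvalues of $A^{-1}$ are the inverses of
those of $A$, so the spectral radius of $A^{-1}$ is the inverse of the least
eigenvalue of $A$. *)
Lemma spectral_radius_inv n (A : 'M[R]_n) (r := spectral_radius (invmx A)) :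
  (0 < n)%N -> A^T = A -> (forall x : 'cV[R]_n, x != 0 -> 0 < dot x (A *m x)) ->
  [/\ 0 < r, forall x : 'cV[R]_n, r^-1 * dot x x <= dot x (A *m x) &
      exists2 x : 'cV[R]_n, x != 0 & A *m x = r^-1 *: x].
Proof.
move=> n_gt0 symA posA.
have [P [d [PP PA]]] := symmetric_spectral symA.
have d_gt0 i : 0 < d 0 i.
  have [x x0 Ax] := diag_real_eigenvector PP PA i symA.
  by have := posA x x0; rewrite Ax dotZr pmulr_lgt0 ?dot_gt0.
have uA : A \in unitmx.
  rewrite -row_free_unit -kermx_eq0; apply/eqP/row_matrixP => i; rewrite row0.
  apply/eqP; apply: contraT => k0; have := posA (row i (kermx A))^T.
  have -> : A *m (row i (kermx A))^T = 0.
    by apply: trmx_inj; rewrite trmx_mul trmxK symA -row_mul mulmx_ker row0 trmx0.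
  by rewrite trmx_eq0 dotE mulmx0 mxE ltxx => /(_ k0).
pose d' := \row_i (d 0 i)^-1.
have PA' : P *m (invmx A)^R = diag_mx d'^R *m P.
  rewrite map_invmx; apply: (canLR (mulmxK _)); first by rewrite map_unitmx.
  rewrite -mulmxA PA mulmxA mulmx_diag -[LHS]mul1mx; congr (_ *m _).
  apply/matrixP => i j; rewrite !mxE -rmorphM /= mulVf ?lt0r_neq0 ?d_gt0 ?rmorph1 ?mulr1n //.
have rE : r = \big[Num.max/0]_i (d 0 i)^-1.
  rewrite /r /spectral_radius (perm_big _ (spectrum_diag PP PA')) big_map big_enum.
  apply: eq_bigr => i _; rewrite mxE /= expr0n addr0 sqrtr_sqr ger0_norm //.
  by rewrite invr_ge0 ltW.
have [i ri] : {i | r = (d 0 i)^-1}.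
  rewrite rE; case: (@eq_bigmax _ R _ 0 (Ordinal n_gt0) xpredT (fun i => (d 0 i)^-1)
    isT) => [i _|i _ ->]; last by exists i.
  by rewrite invr_ge0 ltW.
have r_gt0 : 0 < r by rewrite ri invr_gt0.
split=> //; last first.
  by rewrite ri invrK; exact: diag_real_eigenvector PP PA i symA.
move=> x; apply: (rayleigh_spectral PP PA) => j _.
by rewrite -[leRHS]invrK lef_pV2 ?posrE ?invr_gt0 // rE le_bigmax.
Qed.

(** When the kernel is a line, zero is a simple eigenvalue, hence the sorted
list is 0 followed by the sorted positive eigenvalues, and a vector orthogonal
to the kernel only has coordinates on the latter. *)
Lemma second_eigenvalue n (A : 'M[R]_n) (s : 'cV[R]_n) (l := (sorted_eigenvalues A)`_1) :
  (1 < n)%N -> A^T = A -> (forall x : 'cV[R]_n, 0 <= dot x (A *m x)) ->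
  s != 0 -> A *m s = 0 -> (forall x : 'cV[R]_n, A *m x = 0 -> exists a, x = a *: s) ->
  0 < l /\ forall x : 'cV[R]_n, dot x s = 0 -> l * dot x x <= dot x (A *m x).
Proof.
move=> n_gt1 symA psdA s0 As kerA.
have [P [d [PP PA]]] := symmetric_spectral symA.
have d_ge0 i : 0 <= d 0 i.
  have [x x0 Ax] := diag_real_eigenvector PP PA i symA.
  by have := psdA x; rewrite Ax dotZr pmulr_lge0 ?dot_gt0.
pose c := P *m s^R.
have dc i : d 0 i != 0 -> c i 0 = 0.
  move=> di; have: diag_mx d^R *m c = 0.
    by rewrite mulmxA -PA -mulmxA -map_mxM As map_mx0 mulmx0.
  move/matrixP/(_ i 0); rewrite mul_diag_mx !mxE => /eqP.
  by rewrite mulf_eq0 fmorph_eq0 (negPf di) => /eqP.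
have [i0 ci0] : exists i, c i 0 != 0.
  apply/existsP; apply: contraR s0; rewrite negb_exists => /forallP c0.
  rewrite -dot_eq0 -(inj_eq (@complexI R)) (dot_spectral PP) big1 // => i _.
  by have /negPn/eqP -> := c0 i; rewrite mulr0.
have d0 : d 0 i0 = 0 by apply/eqP; apply: contraR ci0 => /dc ->.
(* a row of P with eigenvalue 0 is a complex multiple of s: its real and
   imaginary parts are in the kernel of A *)
have rowP i : d 0 i = 0 -> exists z, forall j, P i j = z * toC (s j 0).
  move=> di; have Pi : row i P *m A^R = 0.
    by rewrite -row_mul PA row_mul row_diag_mx -scalemxAl -rowE mxE di scale0r.
  have ker (f : R[i] -> R) : (forall z a, f (z * toC a) = f z * a) ->
     {morph f : x y / x + y} -> f 0 = 0 ->
     exists a, forall j, f (P i j) = a * s j 0.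
    move=> fM fD f0; have [|a xa] := kerA (\col_j f (P i j)); last first.
      by exists a => j; have /matrixP/(_ j 0) := xa; rewrite !mxE.
    apply/matrixP => k l'; rewrite ord1 !mxE -{1}symA.
    have /matrixP/(_ 0 k) := Pi; rewrite !mxE => /(congr1 f).
    rewrite f0 (big_morph f fD f0); apply: etrans; apply: eq_bigr => j _.
    by rewrite !mxE fM mulrC.
  have [||a aP] := ker (@complex.Re R) _ _ erefl.
  - by move=> [z1 z2] t /=; rewrite mulr0 subr0.
  - by move=> [x1 x2] [y1 y2].
  have [||b bP] := ker (@complex.Im R) _ _ erefl.
  - by move=> [z1 z2] t /=; rewrite mulr0 add0r.
  - by move=> [x1 x2] [y1 y2].
  exists (Complex a b) => j; have := aP j; have := bP j.
  by case: (P i j) => p q /= -> ->; apply/eqP; rewrite eq_complex /= !mulr0 subr0 add0r !eqxx.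
(* two orthogonal rows cannot both be nonzero multiples of s *)
have d_gt0 i : i != i0 -> 0 < d 0 i.
  move=> ii0; rewrite lt0r d_ge0 andbT; apply/eqP => /rowP[z zP].
  have [z0 z0P] := rowP i0 d0.
  have PPij k l' y y' : (forall j, P k j = y * toC (s j 0)) ->
     (forall j, P l' j = y' * toC (s j 0)) ->
     (P *m P^H) k l' = y * Num.conj y' * toC (dot s s).
    move=> yP y'P; rewrite mxE rmorph_sum mulr_sumr; apply: eq_bigr => j _.
    rewrite 2!mxE yP y'P !rmorphM /=.
    by rewrite [Num.conj (toC _)]conjc_real mulrACA.
  have := PPij _ _ _ _ zP zP; have := PPij _ _ _ _ z0P z0P.
  have := PPij _ _ _ _ zP z0P.
  rewrite PP !mxE !eqxx (negPf ii0) => /esym/eqP E1 E2 E3.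
  move: E1; rewrite !mulf_eq0 conjC_eq0 -orbA => /or3P[] /eqP E0.
  - by move/eqP: E3; rewrite E0 !mul0r oner_eq0.
  - by move/eqP: E2; rewrite E0 !mul0r oner_eq0.
  - by move/eqP: E3; rewrite E0 mulr0 oner_eq0.
pose m := [seq d 0 i | i <- rem i0 (enum 'I_n)].
have enumP : perm_eq (enum 'I_n) (i0 :: rem i0 (enum 'I_n)).
  by apply: perm_to_rem; rewrite mem_enum.
have memr i : (i \in rem i0 (enum 'I_n)) = (i != i0).
  by rewrite mem_rem_uniq ?enum_uniq // inE mem_enum andbT.
have szm : size (sort <=%R m) = n.-1.
  by rewrite size_sort size_map size_rem ?mem_enum // size_enum_ord.
have lE : l = (sort <=%R m)`_0.
  rewrite /l /sorted_eigenvalues.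
  suff -> : sort <=%R [seq complex.Re z | z <- spectrum A] = 0 :: sort <=%R m by [].
  apply: le_sorted_eq; first exact: sort_le_sorted.
    rewrite /= path_min_sorted ?sort_le_sorted //; apply/allP => y.
    by rewrite mem_sort => /mapP[i _ ->].
  rewrite perm_sort (perm_trans (perm_map _ (spectrum_diag PP PA))) //.
  rewrite -map_comp /= (perm_trans (perm_map _ enumP)) //= d0 perm_cons.
  by rewrite perm_sym perm_sort.
have l_le i : i != i0 -> l <= d 0 i.
  move=> ii0; have: d 0 i \in sort <=%R m by rewrite mem_sort map_f // memr.
  rewrite lE; have := sort_le_sorted m; case: (sort _ m) => //= a t.
  rewrite (path_sortedE le_trans) => /andP[/allP at_ _].
  by rewrite inE => /predU1P[->//|/at_].
have l_gt0 : 0 < l.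
  have : l \in m.
    by rewrite lE -(mem_sort <=%R) mem_nth // szm; case: (n) n_gt1 => [|[]].
  by case/mapP => i; rewrite memr => /d_gt0 ? ->.
split=> // x xs; apply: (rayleigh_spectral PP PA) => i.
apply: contraNle => di; have -> : i = i0.
  by apply/eqP; apply: contraLR di => /l_le; rewrite leNgt.
have := dot_spectral PP x s; rewrite xs (bigD1 i0) //= big1 => [|j ji].
  by rewrite addr0 => /esym/eqP; rewrite mulf_eq0 (negPf ci0) orbF conjC_eq0.
by rewrite (dc j) ?mulr0 // gt_eqF ?d_gt0.
Qed.

End Spectral.

(** * The least eigenvalue of a principal submatrix *)

Definition supported (R : rcfType) n (C : {set 'I_n}) (x : 'cV[R]_n) :=
  forall u, u \notin C -> x u 0 = 0.

Section PrincipalSubmatrix.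
Variables (R : rcfType) (n : nat) (C : {set 'I_n}).

(** Multiplication by this matrix extends a vector by zero outside $C$, and its
transpose restricts a vector to $C$. *)
Definition ext_mx : 'M[R]_(n, #|C|) := \matrix_(u, i) (u == enum_val i)%:R.

Lemma ext_mx_tr (x : 'cV[R]_n) i : (ext_mx^T *m x) i 0 = x (enum_val i) 0.
Proof.
rewrite mxE (bigD1 (enum_val i)) //= !mxE eqxx mul1r big1 ?addr0 // => u ui.
by rewrite !mxE (negPf ui) mul0r.
Qed.

Lemma ext_mx_supported (y : 'cV[R]_#|C|) : supported C (ext_mx *m y).
Proof.
move=> u uC; rewrite mxE big1 // => i _; rewrite mxE; case: eqP => [uE|_].
  by rewrite uE enum_valP in uC.
by rewrite mul0r.
Qed.

Lemma ext_mxK (y : 'cV[R]_#|C|) : ext_mx^T *m (ext_mx *m y) = y.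
Proof.
apply/matrixP => i j; rewrite ord1 ext_mx_tr mxE (bigD1 i) //= mxE eqxx mul1r.
rewrite big1 ?addr0 // => k ki; rewrite mxE (inj_eq enum_val_inj) eq_sym.
by rewrite (negPf ki) mul0r.
Qed.

Lemma ext_mx_trK x : supported C x -> ext_mx *m (ext_mx^T *m x) = x.
Proof.
move=> Cx; apply/matrixP => u j; rewrite ord1.
have [uC|uC] := boolP (u \in C); last by rewrite ext_mx_supported ?Cx.
rewrite -(enum_rankK_in uC uC) -[LHS]ext_mx_tr ext_mxK.
by rewrite ext_mx_tr.
Qed.

Lemma principal_submxE (A : 'M[R]_n) :
  principal_submx A C = ext_mx^T *m A *m ext_mx.
Proof.
apply/matrixP => i j; rewrite -mulmxA mxE.
have := ext_mx_tr (A *m col j ext_mx) i.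
rewrite colE !mulmxA -colE mxE -mulmxA => ->.
rewrite -mulmxA -colE mxE (bigD1 (enum_val j)) //= !mxE eqxx mulr1.
by rewrite big1 ?addr0 // => u uj; rewrite !mxE (negPf uj) mulr0.
Qed.

(** The variational description of the least eigenvalue of a principal
submatrix, transported to vectors on the whole index set that vanish outside
$C$; these are easier to compare for different $C$. *)
Lemma principal_submx_bottom (A : 'M[R]_n)
    (r := spectral_radius (invmx (principal_submx A C))) :
  C != set0 -> A^T = A ->
  (forall x : 'cV[R]_n, supported C x -> x != 0 -> 0 < dot x (A *m x)) ->
  [/\ 0 < r,
      forall x : 'cV[R]_n,
        supported C x -> r^-1 * dot x x <= dot x (A *m x) &
      exists x : 'cV[R]_n, [/\ supported C x, x != 0 &
        forall u, u \in C -> (A *m x) u 0 = r^-1 * x u 0]].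
Proof.
move=> C0 symA posA; set B := principal_submx A C in r *.
have BE := principal_submxE A; rewrite -/B in BE.
have symB : B^T = B by rewrite BE !trmx_mul trmxK symA mulmxA.
have dotB (y : 'cV[R]_#|C|) : dot y (B *m y) = dot (ext_mx *m y) (A *m (ext_mx *m y)).
  by rewrite dot_mull BE !mulmxA.
have [||y y0|r_gt0 rB [y y0 By]] := @spectral_radius_inv R _ B => //.
- by rewrite card_gt0.
- rewrite dotB posA //; first exact: ext_mx_supported.
  by apply: contraNneq y0 => Ey; rewrite -(ext_mxK y) Ey mulmx0.
split=> // [x Cx|].
  have := rB (ext_mx^T *m x).
  by rewrite dotB ext_mx_trK // dot_mull trmxK ext_mx_trK.
exists (ext_mx *m y); split; first exact: ext_mx_supported.
  by apply: contraNneq y0 => Ey; rewrite -(ext_mxK y) Ey mulmx0.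
move=> u uC; rewrite -(enum_rankK_in uC uC) -!ext_mx_tr ext_mxK.
by rewrite !mulmxA -BE By mxE.
Qed.

End PrincipalSubmatrix.

(** * The normalized Laplacian of a tree *)

Section Laplacian.
Variables (R : rcfType) (n : nat) (e : rel 'I_n).
Hypotheses (n_gt1 : (1 < n)%N) (treeE : is_tree e).
Local Notation L := (norm_laplacian R e).
Local Notation lam := (lambda1 R e).

Let e_sym : symmetric e := tree_sym treeE.
Let e_irr : irreflexive e := tree_irr treeE.
Let e_conn u w : connect e u w := tree_connected treeE u w.

Definition sqrt_deg : 'cV[R]_n := \col_u Num.sqrt (degree e u)%:R.
Local Notation s u := (sqrt_deg u 0).

Lemma degree_gt0 u : (0 < degree e u)%N.
Proof.
have [w uw] : exists w : 'I_n, u != w.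
  have n_gt0 : (0 < n)%N := ltnW n_gt1.
  have [->|u0] := eqVneq u (Ordinal n_gt0); first by exists (Ordinal n_gt1).
  by exists (Ordinal n_gt0).
have /connectP[[/= _ wu|w' p /= /andP[euw' _] _]] := e_conn u w.
  by rewrite wu eqxx in uw.
by apply/card_gt0P; exists w'; rewrite inE.
Qed.

Lemma sqrt_deg_gt0 u : 0 < s u.
Proof. by rewrite mxE sqrtr_gt0 ltr0n degree_gt0. Qed.

Lemma sqrt_deg_neq0 u : s u != 0.
Proof. exact: lt0r_neq0 (sqrt_deg_gt0 u). Qed.

Lemma sqrt_deg_sqr u : s u ^+ 2 = (degree e u)%:R.
Proof. by rewrite mxE sqr_sqrtr ?ler0n. Qed.

Lemma sum_degree u (a : R) : \sum_(w | e u w) a = (degree e u)%:R * a.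
Proof. 
rewrite sumr_const mulr_natl; congr (_ *+ _).
by apply: eq_card => w; rewrite inE. Qed.

Lemma laplacian_diag u : L u u = 1.
Proof. by rewrite mxE eqxx. Qed.

Lemma laplacian_edge u w : e u w -> L u w = - (s u * s w)^-1.
Proof.
move=> uw; rewrite !mxE uw; case: eqP => [eq_uw|_].
  by rewrite eq_uw e_irr in uw.
by rewrite sqrtrM ?ler0n // div1r.
Qed.

Lemma laplacian_nonedge u w : u != w -> ~~ e u w -> L u w = 0.
Proof. by move=> uw euw; rewrite mxE (negPf uw) (negPf euw). Qed.

Lemma laplacian_le0 u w : u != w -> L u w <= 0.
Proof.
move=> uw; have [euw|/laplacian_nonedge-> //] := boolP (e u w).
by rewrite laplacian_edge // oppr_le0 invr_ge0 mulr_ge0 // ltW ?sqrt_deg_gt0.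
Qed.

Lemma laplacian_sym : L^T = L.
Proof.
apply/matrixP => u w; rewrite !mxE (eq_sym w) (e_sym w).
by rewrite (mulrC (degree e w)%:R).
Qed.

Lemma laplacianE (x : 'cV[R]_n) u :
  (L *m x) u 0 = x u 0 - \sum_(w | e u w) x w 0 / (s u * s w).
Proof.
rewrite mxE (bigD1 u) //= laplacian_diag mul1r; congr (_ + _).
rewrite -sumrN [RHS]big_mkcond [LHS]big_mkcond /=; apply: eq_bigr => w _.
have [->|wu] := eqVneq w u; first by rewrite e_irr.
rewrite eq_sym in wu; case: ifP => [euw|/negbT euw].
  by rewrite laplacian_edge // mulNr mulrC.
by rewrite laplacian_nonedge ?mul0r.
Qed.

Lemma laplacian_sqrt_deg : L *m sqrt_deg = 0.
Proof.
apply/matrixP => u j; rewrite ord1 laplacianE [RHS]mxE.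
under eq_bigr => w _ do rewrite invfM mulrCA divff ?sqrt_deg_neq0 // mulr1.
by rewrite sum_degree -sqrt_deg_sqr expr2 mulfK ?sqrt_deg_neq0 // subrr.
Qed.

(** Expanding the squares, the diagonal terms give $2\langle x, x\rangle$
because $x_u^2/d_u$ occurs twice, in either position of the pair, for each of
the $d_u$ edges at $u$. *)
Lemma laplacian_form (x : 'cV[R]_n) : dot x (L *m x) *+ 2 =
  \sum_u \sum_(w | e u w) (x u 0 / s u - x w 0 / s w) ^+ 2.
Proof.
pose S := \sum_u \sum_(w | e u w) (x u 0 / s u) ^+ 2.
pose T := \sum_u \sum_(w | e u w) (x u 0 / s u) * (x w 0 / s w).
have SE : S = dot x x.
  apply: eq_bigr => u _; rewrite sum_degree -sqrt_deg_sqr.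
  by rewrite expr_div_n mulrC divfK ?expf_neq0 ?sqrt_deg_neq0.
have S'E : \sum_u \sum_(w | e u w) (x w 0 / s w) ^+ 2 = S.
  rewrite (exchange_big_dep xpredT) //=; apply: eq_bigr => u _.
  by apply: eq_bigl => w; rewrite e_sym.
have TE : dot x (L *m x) = S - T.
  rewrite SE -sumrB; apply: eq_bigr => u _; rewrite laplacianE mulrBr.
  congr (_ - _); rewrite mulr_sumr; apply: eq_bigr => w _.
  by rewrite invfM !mulrA; ring.
transitivity (S - T *+ 2 + S); first by rewrite TE; ring.
rewrite -{2}S'E -sumrMnl -sumrB -big_split; apply: eq_bigr => u _ /=.
rewrite -sumrMnl -sumrB -big_split; apply: eq_bigr => w _ /=.
by rewrite sqrrB.
Qed.

Lemma laplacian_psd (x : 'cV[R]_n) : 0 <= dot x (L *m x).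
Proof.
rewrite -(@pmulrn_lge0 _ _ 2) // laplacian_form.
by apply: sumr_ge0 => u _; apply: sumr_ge0 => w _; apply: sqr_ge0.
Qed.

Lemma laplacian_ker (x : 'cV[R]_n) :
  dot x (L *m x) = 0 -> exists a, x = a *: sqrt_deg.
Proof.
move=> x0; have: dot x (L *m x) *+ 2 = 0 by rewrite x0 mul0rn.
rewrite laplacian_form => /eqP.
rewrite psumr_eq0 => [/allP sum0|u _]; last first.
  by apply: sumr_ge0 => w _; apply: sqr_ge0.
have edge u w : e u w -> x u 0 / s u = x w 0 / s w.
  move=> uw; have := sum0 u (mem_index_enum _); rewrite psumr_eq0 /=.
    by move/allP/(_ w (mem_index_enum _)); rewrite uw sqrf_eq0 subr_eq0 => /eqP.
  by move=> *; apply: sqr_ge0.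
pose u0 := Ordinal (ltnW n_gt1); pose a := x u0 0 / s u0.
exists a; apply/matrixP => u j; rewrite ord1 mxE.
have cl : closed e [pred u | x u 0 / s u == a].
  by move=> w w' /edge; rewrite !inE => ->.
have := closed_connect cl (e_conn u0 u); rewrite !inE eqxx => /esym/eqP <-.
by rewrite divfK ?sqrt_deg_neq0.
Qed.

Lemma sqrt_deg_vec_neq0 : sqrt_deg != 0.
Proof.
apply/eqP => /matrixP/(_ (Ordinal n_gt1) 0)/eqP.
by rewrite [X in _ == X]mxE (negPf (sqrt_deg_neq0 _)).
Qed.

(** The kernel is the line of $s$, so the Rayleigh quotient on the orthogonal
complement of $s$ is bounded below by the second eigenvalue. *)
Lemma lambda1_gap : 0 < lam /\
  forall x : 'cV[R]_n, dot x sqrt_deg = 0 -> lam * dot x x <= dot x (L *m x).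
Proof.
apply: second_eigenvalue => //.
- exact: laplacian_sym.
- exact: laplacian_psd.
- exact: sqrt_deg_vec_neq0.
- exact: laplacian_sqrt_deg.
- by move=> x Lx; apply: laplacian_ker; rewrite Lx dotE mulmx0 mxE.
Qed.

Lemma lambda1_ortho g : L *m g = lam *: g -> dot g sqrt_deg = 0.
Proof.
move=> Lg; have := dot_mull L g sqrt_deg.
rewrite laplacian_sym laplacian_sqrt_deg Lg dotZl [RHS]dotE mulmx0 mxE => /eqP.
by rewrite mulf_eq0 gt_eqF ?(proj1 lambda1_gap) // => /eqP.
Qed.

(** * Branches at a vertex *)

Section Branches.
Implicit Types (C D E : {set 'I_n}) (g x y p q : 'cV[R]_n).
Variable v : 'I_n.

Lemma del_connect_equiv : {in [set~ v] & &, equivalence_rel (connect (del_vertex e v))}.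
Proof.
have sym : connect_sym (del_vertex e v).
  by apply: sym_connect_sym => u w; rewrite /del_vertex /= e_sym andbCA.
move=> x y z _ _ _; split=> [|xy]; first exact: connect0.
by apply: same_connect.
Qed.

Lemma branches_partition : partition (branches e v) [set~ v].
Proof. exact: equivalence_partitionP del_connect_equiv. Qed.

Lemma branch_cover u : u != v -> exists2 C, C \in branches e v & u \in C.
Proof.
have /and3P[/eqP cov _ _] := branches_partition.
by rewrite -in_setC1 -cov => /bigcupP[C]; exists C.
Qed.

Lemma branch_connect C u : C \in branches e v -> u \in C ->
  forall w, (w \in C) = (w != v) && connect (del_vertex e v) u w.
Proof.
move=> CB uC w; have part := branches_partition.
have /and3P[/eqP cov triv _] := part.
have inV w' : w' \in C -> w' != v.
  by move=> wC; rewrite -in_setC1 -cov; apply/bigcupP; exists C.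
have [->|wv] /= := eqVneq w v; first by apply: contraTF isT => /inV; rewrite eqxx.
rewrite -(def_pblock triv CB uC) pblock_equivalence_partition ?inE ?(inV u uC) //.
exact: del_connect_equiv.
Qed.

Lemma branch_center C : C \in branches e v -> v \notin C.
Proof.
by move=> CB; apply/negP => /[dup]/(branch_connect CB)->; rewrite eqxx.
Qed.

Lemma branch_neighbor C u w :
  C \in branches e v -> u \in C -> e u w -> w != v -> w \in C.
Proof.
move=> CB uC uw wv; rewrite (branch_connect CB uC) wv connect1 // /del_vertex /= wv uw !andbT.
by apply: contraTneq uC => ->; apply: branch_center.
Qed.

Lemma branch_neq0 C : C \in branches e v -> C != set0.
Proof.
by move=> CB; apply: contraTneq CB => ->; have /and3P[] := branches_partition.
Qed.

Lemma branch_disjoint C D u : C \in branches e v -> D \in branches e v ->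
  u \in C -> u \in D -> C = D.
Proof.
move=> CB DB uC uD; have /and3P[_ triv _] := branches_partition.
by rewrite -(def_pblock triv CB uC) (def_pblock triv DB uD).
Qed.

Lemma branch_root C : C \in branches e v -> exists2 w, w \in C & e v w.
Proof.
move=> CB; apply/exists_inP; apply: contraT => /exists_inPn noroot.
have [u uC] := set0Pn _ (branch_neq0 CB).
have cl : closed e (mem C).
  apply: intro_closed => [|x y xy xC]; first exact: sym_connect_sym.
  apply: (branch_neighbor CB xC xy); apply: contraTneq xy => ->.
  by rewrite e_sym noroot.
by have := closed_connect cl (e_conn u v); rewrite /= uC (negPf (branch_center CB)).
Qed.

(** Two neighbours of $v$ in one branch would be joined by a path avoiding $v$,
which $v$ closes into a cycle. This is where acyclicity enters; on a cycle of
length 4 the theorem fails. *)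
Lemma branch_root_unique C u w : C \in branches e v ->
  u \in C -> w \in C -> e v u -> e v w -> u = w.
Proof.
move=> CB uC wC vu vw; have := wC; rewrite (branch_connect CB uC).
case/andP => wv /connectP[p0 /shortenP[p pth up _] wE].
have vp : v \notin u :: p.
  have : all (predC1 v) (u :: p).
    rewrite /= (contraTneq _ uC) => [|->]; last exact: branch_center.
    elim: p u pth {up wE wC vu uC} => //= x p IH u /andP[/and3P[_ -> _] /IH].
    by [].
  by move/allP => pv; apply/negP => /pv /=; rewrite eqxx.
have pe : path e u p by apply: sub_path pth => x y /and3P[].
have : ucycle e (v :: u :: p).
  by rewrite /ucycle /= rcons_path vu pe -wE e_sym vw /= -cons_uniq /= vp.
by move/(tree_acyclic treeE); case: p wE {pth up vp pe} => //= <-.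
Qed.

(** * Perron vectors of branches *)

Definition bottom C : R := (spectral_radius (bottleneck R e C))^-1.

Lemma branch_bottom C : C \in branches e v ->
  [/\ 0 < spectral_radius (bottleneck R e C),
      forall x : 'cV[R]_n,
        supported C x -> bottom C * dot x x <= dot x (L *m x) &
      exists x : 'cV[R]_n, [/\ supported C x, x != 0 &
        forall u, u \in C -> (L *m x) u 0 = bottom C * x u 0]].
Proof.
move=> CB; apply: principal_submx_bottom; first exact: branch_neq0 CB.
  exact: laplacian_sym.
move=> x Cx x0; rewrite lt0r laplacian_psd andbT.
apply: contraNneq x0 => /laplacian_ker[a xE].
have /eqP := Cx v (branch_center CB).
rewrite xE mxE mulf_eq0 (negPf (sqrt_deg_neq0 v)) orbF => /eqP ->.
by rewrite scale0r.
Qed.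

Lemma supported_eigen_form C (mu : R) (x : 'cV[R]_n) : supported C x ->
  (forall u, u \in C -> (L *m x) u 0 = mu * x u 0) ->
  dot x (L *m x) = mu * dot x x.
Proof.
move=> Cx Lx; rewrite mulr_sumr; apply: eq_bigr => u _.
have [uC|/Cx->] := boolP (u \in C); last by rewrite !mul0r mulr0.
by rewrite Lx // mulrCA.
Qed.

(** First variation of the Rayleigh quotient at the minimizer $y$, in the
direction of a vertex $u$ of $C$. *)
Lemma minimizer_eigen C y : C \in branches e v -> supported C y ->
  dot y (L *m y) <= bottom C * dot y y ->
  forall u, u \in C -> (L *m y) u 0 = bottom C * y u 0.
Proof.
move=> CB Cy ymin u uC; set mu := bottom C in ymin *.
have [_ muP _] := branch_bottom CB; rewrite -/mu in muP.
pose z : 'cV[R]_n := delta_mx u 0.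
have dotz x : dot z x = x u 0.
  rewrite /dot (bigD1 u) //= mxE !eqxx mul1r big1 ?addr0 // => w wu.
  by rewrite mxE (negPf wu) mul0r.
pose b := (L *m y) u 0 - mu * y u 0; pose c := 1 - mu.
have form t : 0 <= t * b *+ 2 + t ^+ 2 * c.
  have /muP : supported C (y + t *: z).
    move=> w wC; rewrite !mxE Cy // (_ : w == u = false) ?mulr0 ?addr0 //.
    by apply: contraNF wC => /eqP ->.
  rewrite mulmxDr -scalemxAr !dotDl !dotDr !dotZl !dotZr !dotz.
  have -> : (L *m z) u 0 = 1 by rewrite -colE mxE laplacian_diag.
  have -> : dot y (L *m z) = (L *m y) u 0.
    by rewrite -dotz [RHS]dotC dot_mull laplacian_sym.
  have -> : z u 0 = 1 by rewrite mxE !eqxx.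
  rewrite (dotC y z) dotz /b /c; nra.
(* with t = - b / (|c| + 1) the quadratic in t is negative unless b = 0 *)
have k_gt0 : 0 < `|c| + 1 by rewrite ltr_wpDl.
apply/eqP; rewrite -subr_eq0 -/b -sqrf_eq0 eq_le sqr_ge0 andbT.
have := form (- b / (`|c| + 1)); have := ler_norm c.
move: (`|c|) k_gt0 => k k0 ck.
have -> : - b / (k + 1) * b *+ 2 + (- b / (k + 1)) ^+ 2 * c =
          - (b ^+ 2 * ((k + 1) *+ 2 - c)) / (k + 1) ^+ 2.
  by field; rewrite gt_eqF.
rewrite pmulr_lge0 ?invr_gt0 ?exprn_gt0 // oppr_ge0.
rewrite pmulr_lle0 //; lra.
Qed.

Definition absv (x : 'cV[R]_n) : 'cV[R]_n := \col_u `|x u 0|.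

Lemma dot_absv x : dot (absv x) (absv x) = dot x x.
Proof.
by apply: eq_bigr => u _; rewrite mxE -normrM ger0_norm // -expr2 sqr_ge0.
Qed.

(** The loss in the contribution of one edge to the quadratic form when $x$ is
replaced by its absolute value. *)
Definition edge_defect (x : 'cV[R]_n) u w := (x u 0 / s u - x w 0 / s w) ^+ 2 -
   (absv x u 0 / s u - absv x w 0 / s w) ^+ 2.

Lemma edge_defectE x u w : edge_defect x u w =
  (`|x u 0 * x w 0| - x u 0 * x w 0) *+ 2 / (s u * s w).
Proof.
rewrite /edge_defect !(mxE _ (fun u j => `|x u 0|)) normrM.
set p := s u; set q := s w; have p0 : p != 0 by exact: sqrt_deg_neq0.
have q0 : q != 0 by exact: sqrt_deg_neq0.
have a2 : `|x u 0| ^+ 2 = x u 0 ^+ 2 by rewrite real_normK ?num_real.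
have b2 : `|x w 0| ^+ 2 = x w 0 ^+ 2 by rewrite real_normK ?num_real.
rewrite !sqrrB !expr_div_n a2 b2; field; exact/andP.
Qed.

Lemma edge_defect_ge0 x u w : 0 <= edge_defect x u w.
Proof.
rewrite edge_defectE divr_ge0 ?mulrn_wge0 ?subr_ge0 ?ler_norm //.
by rewrite mulr_ge0 // ltW ?sqrt_deg_gt0.
Qed.

Lemma absv_form x : (dot x (L *m x) - dot (absv x) (L *m absv x)) *+ 2 =
  \sum_u \sum_(w | e u w) edge_defect x u w.
Proof.
rewrite mulrnBl !laplacian_form -sumrB; apply: eq_bigr => u _.
by rewrite -sumrB.
Qed.

(** The absolute value of $x$ does not increase the form, so it is a minimizer
too and no edge has a positive defect, that is, no edge changes sign. At a zero
of the nonnegative eigenvector $|x|$ the eigenvalue equation makes all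
neighbours zero; connectedness would then make $x$ vanish on $C$. *)
Lemma perron_sign C x : C \in branches e v -> supported C x -> x != 0 ->
  (forall u, u \in C -> (L *m x) u 0 = bottom C * x u 0) ->
  [/\ forall u, u \in C -> x u 0 != 0,
      forall u w, e u w -> 0 <= x u 0 * x w 0 &
      forall u, u \in C -> (L *m absv x) u 0 = bottom C * absv x u 0].
Proof.
move=> CB Cx x0 Lx; set y := absv x.
have [_ muP _] := branch_bottom CB.
have Cy : supported C y by move=> u uC; rewrite mxE Cx ?normr0.
have xE := supported_eigen_form Cx Lx.
have defect0 : \sum_u \sum_(w | e u w) edge_defect x u w = 0.
  apply/eqP; rewrite eq_le -{1}absv_form xE -dot_absv pmulrn_lle0 // subr_le0.
  rewrite muP //=; apply: sumr_ge0 => u _; apply: sumr_ge0 => w _.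
  exact: edge_defect_ge0.
have ymin : dot y (L *m y) <= bottom C * dot y y.
  rewrite dot_absv -xE -subr_ge0 -(@pmulrn_lge0 _ _ 2) // absv_form defect0.
  exact: lexx.
have Ly := minimizer_eigen CB Cy ymin.
have y_ge0 u : 0 <= y u 0 by rewrite mxE normr_ge0.
have spread u w : u \in C -> y u 0 = 0 -> e u w -> y w 0 = 0.
  move=> uC yu euw; have := Ly u uC; rewrite laplacianE yu mulr0 sub0r => /eqP.
  have term_ge0 w' : 0 <= y w' 0 / (s u * s w').
    by rewrite divr_ge0 // mulr_ge0 // ltW ?sqrt_deg_gt0.
  rewrite oppr_eq0 psumr_eq0 // => /allP/(_ w (mem_index_enum _)).
  rewrite euw mulf_eq0 invr_eq0 mulf_eq0 !(negPf (sqrt_deg_neq0 _)) !orbF.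
  by move/eqP.
split=> //.
- move=> u uC; apply: contra x0 => /eqP xu; apply/eqP/matrixP => w j.
  rewrite ord1 [RHS]mxE; have [wC|/Cx//] := boolP (w \in C).
  have cl : closed (del_vertex e v) [pred w | (w \in C) && (y w 0 == 0)].
    apply: intro_closed => [|w1 w2 /and3P[_ w2v w12]].
      by apply: sym_connect_sym => a b; rewrite /del_vertex /= e_sym andbCA.
    rewrite !inE => /andP[w1C /eqP y1]; rewrite (branch_neighbor CB w1C) //=.
    by rewrite (spread w1).
  move: (wC); rewrite (branch_connect CB uC) => /andP[_ /(closed_connect cl)].
  by rewrite !inE uC wC mxE xu normr0 eqxx mxE normr_eq0 => /esym/eqP.
- move=> u w euw; move/eqP: defect0; rewrite psumr_eq0 => [/allP d0|u' _].
    have := d0 u (mem_index_enum _); rewrite psumr_eq0 /=; last first.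
      by move=> *; apply: edge_defect_ge0.
    move/allP/(_ w (mem_index_enum _)); rewrite euw edge_defectE mulf_eq0.
    rewrite invr_eq0 mulf_eq0 !(negPf (sqrt_deg_neq0 _)) !orbF mulrn_eq0 /=.
    by rewrite subr_eq0 => /eqP <-.
  by apply: sumr_ge0 => w' _; apply: edge_defect_ge0.
Qed.

Lemma perron_vector C : C \in branches e v ->
  exists p : 'cV[R]_n, [/\ supported C p, forall u, u \in C -> 0 < p u 0 &
    forall u, u \in C -> (L *m p) u 0 = bottom C * p u 0].
Proof.
move=> CB; have [_ _ [x [Cx x0 Lx]]] := branch_bottom CB.
have [xn0 _ Ly] := perron_sign CB Cx x0 Lx.
exists (absv x); split=> // u uC; first by rewrite mxE Cx ?normr0.
by rewrite mxE normr_gt0 xn0.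
Qed.

Lemma supported_dot_gt0 C (p q : 'cV[R]_n) : C \in branches e v -> supported C p ->
  (forall u, u \in C -> 0 < p u 0) -> (forall u, u \in C -> 0 < q u 0) ->
  0 < dot p q.
Proof.
move=> CB Cp pP qP; have [u uC] := set0Pn _ (branch_neq0 CB).
rewrite /dot (bigD1 u) //= ltr_pwDl ?mulr_gt0 ?pP ?qP //.
apply: sumr_ge0 => w _; have [wC|/Cp->] := boolP (w \in C).
  by rewrite ltW // mulr_gt0 ?pP ?qP.
by rewrite mul0r.
Qed.

(** The test vector is $\langle q, s\rangle p - \langle p, s\rangle q$ for the
Perron vectors $p$ of $C$ and $q$ of $D$. It is orthogonal to $s$, and it has no
cross terms, since distinct branches are disjoint and not adjacent. *)
Lemma two_branch_bound C D : C \in branches e v -> D \in branches e v -> C != D ->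
  exists a b, [/\ 0 < a, 0 < b & (lam - bottom C) * a <= (bottom D - lam) * b].
Proof.
move=> CB DB CD.
have [p [Cp pP Lp]] := perron_vector CB.
have [q [Dq qP Lq]] := perron_vector DB.
have offC u : u \in C -> u \notin D.
  by move=> uC; apply: contraNN CD => uD; apply/eqP; apply: branch_disjoint uC uD.
pose a := dot q sqrt_deg; pose b := dot p sqrt_deg.
have a0 : 0 < a by apply: (supported_dot_gt0 DB) => // u _; apply: sqrt_deg_gt0.
have b0 : 0 < b by apply: (supported_dot_gt0 CB) => // u _; apply: sqrt_deg_gt0.
pose y := a *: p - b *: q.
have pq : dot p q = 0.
  apply: big1 => u _; have [/offC/Dq->|/Cp->] := boolP (u \in C).
    by rewrite mulr0.
  by rewrite mul0r.
have pLq : dot p (L *m q) = 0.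
  apply: big1 => u _; have [uC|/Cp->] := boolP (u \in C); last by rewrite mul0r.
  rewrite mxE big1 ?mulr0 // => w _; have [wD|/Dq->] := boolP (w \in D).
    have wC : w \notin C by apply: contraL wD; apply: offC.
    rewrite laplacian_nonedge ?mul0r //; first by apply: contraNneq wC => <-.
    apply: contra wC => uw; apply: (branch_neighbor CB uC uw).
    by apply: contraTneq wD => ->; apply: branch_center.
  by rewrite mulr0.
have qLp : dot q (L *m p) = 0 by rewrite dotC dot_mull laplacian_sym.
have ys : dot y sqrt_deg = 0.
  by rewrite dotDl -scaleNr !dotZl -/a -/b; ring.
have := proj2 lambda1_gap y ys.
rewrite /y -scaleNr mulmxDr -!scalemxAr !dotDl !dotDr !dotZl !dotZr.
rewrite (dotC q p) pq pLq qLp.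
rewrite (supported_eigen_form Cp Lp) (supported_eigen_form Dq Lq) => H.
exists (a ^+ 2 * dot p p), (b ^+ 2 * dot q q).
have pp : 0 < dot p p by apply: (supported_dot_gt0 CB).
have qq : 0 < dot q q by apply: (supported_dot_gt0 DB).
by split; [rewrite mulr_gt0 ?exprn_gt0 | rewrite mulr_gt0 ?exprn_gt0 | nra].
Qed.

(** * Restricting an eigenfunction to the branches *)

Definition restr (C : {set 'I_n}) (g : 'cV[R]_n) : 'cV[R]_n :=
  \col_u if u \in C then g u 0 else 0.

Lemma restr_supported C g : supported C (restr C g).
Proof. by move=> u /negPf uC; rewrite mxE uC. Qed.

Lemma restrE C g u : u \in C -> restr C g u 0 = g u 0.
Proof. by move=> uC; rewrite mxE uC. Qed.

(** A vertex of a branch has neighbours only in the branch and, possibly, at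
$v$. *)
Lemma laplacian_restr C g u : C \in branches e v -> u \in C ->
  (L *m g) u 0 = (L *m restr C g) u 0 + g v 0 * L u v.
Proof.
move=> CB uC; rewrite [LHS]mxE [(L *m restr C g) u 0]mxE.
rewrite [in LHS](bigD1 v) //= [in RHS](bigD1 v) //= restr_supported ?branch_center // mulr0 add0r.
rewrite [LHS]addrC (mulrC (L u v)); congr (_ + _); apply: eq_bigr => w wv.
have [wC|wC] := boolP (w \in C); first by rewrite restrE.
rewrite laplacian_nonedge ?mul0r //; first by apply: contraNneq wC => <-.
by apply: contra wC => uw; apply: (branch_neighbor CB uC).
Qed.

Lemma dot_restr C y g : C \in branches e v -> supported C y ->
  dot y (L *m g) = dot y (L *m restr C g) + g v 0 * dot y (col v L).
Proof.
move=> CB Cy; rewrite -dotZr -dotDr; apply: eq_bigr => u _.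
have [uC|/Cy->] := boolP (u \in C); last by rewrite !mul0r.
by rewrite (laplacian_restr _ CB uC) !mxE.
Qed.

Lemma restr_eigen C g : C \in branches e v -> g v 0 = 0 -> L *m g = lam *: g ->
  forall u, u \in C -> (L *m restr C g) u 0 = lam * restr C g u 0.
Proof.
move=> CB gv Lg u uC; have := laplacian_restr g CB uC.
by rewrite gv mul0r addr0 => <-; rewrite Lg mxE restrE.
Qed.

Lemma bottom_le_lambda1 C g : C \in branches e v -> g v 0 = 0 ->
  L *m g = lam *: g -> restr C g != 0 -> bottom C <= lam.
Proof.
move=> CB gv Lg x0; have [_ muP _] := branch_bottom CB.
have Cx := @restr_supported C g; have := muP _ Cx.
by rewrite (supported_eigen_form Cx (restr_eigen CB gv Lg)) ler_pM2r ?dot_gt0.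
Qed.

Lemma perron_branchP C : reflect
  (C \in branches e v /\ forall D, D \in branches e v -> bottom C <= bottom D)
  (C \in perron_branches R e v).
Proof.
rewrite inE; apply: (iffP andP) => -[CB minC]; split=> //.
  move=> D DB; have [rC _ _] := branch_bottom CB; have [rD _ _] := branch_bottom DB.
  by rewrite lef_pV2 ?posrE //; move/forall_inP: minC; apply.
apply/forall_inP => D DB.
have [rC _ _] := branch_bottom CB; have [rD _ _] := branch_bottom DB.
by have := minC D DB; rewrite lef_pV2 ?posrE.
Qed.

(** * Characteristic vertices have two Perron branches *)

(** Row $v$ of the eigenvalue equation says that a positively weighted sum of
the values of $g$ at the neighbours of $v$ is zero. *)
Lemma opposite_neighbors g w : L *m g = lam *: g -> g v 0 = 0 ->
  e v w -> g w 0 != 0 -> exists2 w', e v w' & g w' 0 * g w 0 < 0.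
Proof.
move=> Lg gv vw gw; apply/exists_inP; apply: contraT => /exists_inPn same.
have: (L *m g) v 0 * g w 0 = 0 by rewrite Lg mxE gv mulr0 mul0r.
rewrite laplacianE gv sub0r mulNr mulr_suml => /eqP; rewrite oppr_eq0.
rewrite psumr_eq0 => [/allP/(_ w (mem_index_enum _))|w' vw'].
  by rewrite vw /= !mulf_eq0 invr_eq0 mulf_eq0 !(negPf (sqrt_deg_neq0 _)) (negPf gw).
rewrite mulrAC divr_ge0 //; first by rewrite leNgt same.
by rewrite mulr_ge0 // ltW ?sqrt_deg_gt0.
Qed.

Lemma characteristic_vertex_branches g : L *m g = lam *: g ->
  is_characteristic_vertex e g v ->
  exists C D, [/\ C \in perron_branches R e v, D \in perron_branches R e v,
    C != D & forall E, E \in perron_branches R e v -> bottom E = lam].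
Proof.
move=> Lg [gv [w vw gw]].
have [w' vw' gw'] := opposite_neighbors Lg gv vw gw.
have neq_v u : e v u -> u != v by apply: contraTneq => ->; rewrite e_irr.
have [C CB wC] := branch_cover (neq_v w vw).
have [D DB wD] := branch_cover (neq_v w' vw').
have CD : C != D.
  apply: contraTneq gw' => eqCD; rewrite -eqCD in wD.
  rewrite (branch_root_unique CB wC wD vw vw').
  by rewrite -leNgt -expr2 sqr_ge0.
have restr_neq0 E u : u \in E -> g u 0 != 0 -> restr E g != 0.
  by move=> uE; apply: contra => /eqP gE; rewrite -(restrE g uE) gE mxE.
have leC : bottom C <= lam.
  exact: bottom_le_lambda1 CB gv Lg (restr_neq0 _ _ wC gw).
have leD : bottom D <= lam.
  apply: bottom_le_lambda1 DB gv Lg (restr_neq0 _ _ wD _).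
  by apply: contraTneq gw' => ->; rewrite mul0r ltxx.
have geE E : E \in branches e v -> lam <= bottom E.
  move=> EB; have [->|ED] := eqVneq E D.
    by have [a [b [a0 b0 ab]]] := two_branch_bound CB DB CD; nra.
  by have [a [b [a0 b0 ab]]] := two_branch_bound EB DB ED; nra.
have eqC : bottom C = lam by apply/le_anti; rewrite leC geE.
exists C, D; split=> //.
- by apply/perron_branchP; split=> // E EB; rewrite eqC geE.
- by apply/perron_branchP; split=> // E EB; rewrite (le_trans leD) ?geE.
- move=> E /perron_branchP[EB minE]; apply/le_anti.
  by rewrite geE // andbT -eqC minE.
Qed.

(** * Two Perron branches make a characteristic vertex *)

Lemma col_laplacian_le0 C u : C \in branches e v -> u \in C -> L u v <= 0.
Proof.
move=> CB uC; apply: laplacian_le0; apply: contraTneq uC => ->.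
exact: branch_center.
Qed.

Lemma perron_dot_col C p : C \in branches e v -> supported C p ->
  (forall u, u \in C -> 0 < p u 0) -> dot p (col v L) < 0.
Proof.
move=> CB Cp pP; have [w wC vw] := branch_root CB.
rewrite -oppr_gt0 /dot -sumrN (bigD1 w) //= mxE ltr_pwDl //.
  rewrite laplacian_edge 1?e_sym // mulrN opprK mulr_gt0 ?pP //.
  by rewrite invr_gt0 mulr_gt0 ?sqrt_deg_gt0.
apply: sumr_ge0 => u _; rewrite mxE; have [uC|/Cp->] := boolP (u \in C).
  by rewrite oppr_ge0 mulr_ge0_le0 ?(col_laplacian_le0 CB) // ltW ?pP.
by rewrite mul0r oppr0.
Qed.

(** Let $y \le 0$ be the negative part of $g$ on $C$. All the off-diagonal
entries of $L$ are nonpositive and $g(v) \ge 0$, so pairing $Lg = \lambda_1 g$ with $y$ gives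
$\langle y, Ly\rangle \le \lambda_1\langle y, y\rangle$, which is below the
least Rayleigh quotient on $C$ unless $y = 0$. *)
Lemma nonneg_of_lt_bottom C g : C \in branches e v -> L *m g = lam *: g ->
  0 <= g v 0 -> lam < bottom C -> forall u, u \in C -> 0 <= g u 0.
Proof.
move=> CB Lg gv lam_lt.
pose y : 'cV[R]_n := \col_u if u \in C then Num.min (g u 0) 0 else 0.
pose h := restr C g - y.
have Cy : supported C y by move=> u /negPf uC; rewrite mxE uC.
have y_le0 u : y u 0 <= 0 by rewrite mxE; case: ifP => // _; rewrite ge_min lexx orbT.
have hE u : h u 0 = if u \in C then Num.max (g u 0) 0 else 0.
  rewrite !mxE; case: ifP => _; last by rewrite subr0.
  by case: (leP (g u 0) 0) => _; rewrite ?subrr ?subr0.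
have h_ge0 u : 0 <= h u 0.
  by rewrite hE; case: ifP => // _; rewrite le_max lexx orbT.
have yh u : y u 0 * h u 0 = 0.
  rewrite hE mxE; case: ifP => _; last by rewrite mul0r.
  by case: (leP (g u 0) 0) => _; rewrite ?mulr0 ?mul0r.
have yg : dot y g = dot y y.
  apply: eq_bigr => u _; have [uC|/Cy->] := boolP (u \in C); last by rewrite !mul0r.
  have hu : h u 0 = g u 0 - y u 0 by rewrite [LHS]mxE [(- y) u 0]mxE restrE.
  have := yh u; rewrite hu mulrBr => /eqP.
  by rewrite subr_eq0 => /eqP.
have yLh : 0 <= dot y (L *m h).
  apply: sumr_ge0 => u _; rewrite [(L *m h) u 0]mxE mulr_sumr; apply: sumr_ge0 => w _.
  have [->|uw] := eqVneq u w; first by rewrite mulrCA yh mulr0.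
  by rewrite mulrA mulr_ge0 // mulr_le0 ?laplacian_le0.
have ycol : 0 <= dot y (col v L).
  apply: sumr_ge0 => u _; rewrite [col v L u 0]mxE.
  have [uC|/Cy->] := boolP (u \in C); last by rewrite mul0r.
  by rewrite mulr_le0 ?(col_laplacian_le0 CB).
have [_ /(_ y Cy) muP _] := branch_bottom CB.
have := dot_restr g CB Cy.
rewrite (_ : restr C g = y + h); last by rewrite addrC subrK.
rewrite Lg dotZr yg mulmxDr dotDr => eq_y.
have /eqP : dot y y = 0.
  have := dot_ge0 y; have := mulr_ge0 gv ycol; nra.
rewrite dot_eq0 => /eqP y0 u uC; rewrite leNgt; apply/negP => gu.
have /matrixP/(_ u 0) := y0; rewrite !mxE uC min_l ?ltW // => gu0.
by rewrite gu0 ltxx in gu.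
Qed.

Section TwoPerron.
Variables (C D : {set 'I_n}).
Hypotheses (CP : C \in perron_branches R e v) (DP : D \in perron_branches R e v).
Hypothesis CD : C != D.

Lemma lambda1_le_perron : lam <= bottom C.
Proof.
have [CB minC] := perron_branchP _ CP; have [DB minD] := perron_branchP _ DP.
have := minC D DB; have := minD C CB.
by have [a [b [a0 b0 ab]]] := two_branch_bound CB DB CD; nra.
Qed.

(** If $g(v) > 0$, pairing with the Perron vector $p$ of $C$ gives
$(\lambda_1 - \mu)\langle p, g\rangle = g(v)\langle p, L e_v\rangle < 0$, so
$\lambda_1 \ne \mu$; then $g \ge 0$ on every branch, although $g$ is
orthogonal to the positive vector $s$. *)
Lemma eigen_center_le0 g : L *m g = lam *: g -> g v 0 <= 0.
Proof.
move=> Lg; rewrite leNgt; apply/negP => gv.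
have [CB minC] := perron_branchP _ CP.
have [p [Cp pP Lp]] := perron_vector CB.
have lt_lam : lam < bottom C.
  rewrite lt_neqAle lambda1_le_perron andbT; apply/eqP => eq_lam.
  have := dot_restr g CB Cp; have := perron_dot_col CB Cp pP.
  have -> : dot p (L *m restr C g) = lam * dot p g.
    rewrite -[L in L *m restr C g]laplacian_sym -dot_mull mulr_sumr.
    apply: eq_bigr => u _; have [uC|uC] := boolP (u \in C).
      by rewrite Lp // restrE // eq_lam mulrA.
    by rewrite restr_supported // Cp // mul0r !mulr0.
  rewrite -(pmulr_rlt0 _ gv) Lg dotZr; lra.
have g_ge0 u : 0 <= g u 0.
  have [->|/branch_cover[E EB uE]] := eqVneq u v; first exact: ltW.
  apply: (nonneg_of_lt_bottom EB Lg) uE; first exact: ltW.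
  exact: lt_le_trans lt_lam (minC E EB).
have := lambda1_ortho Lg; rewrite /dot (bigD1 v) //= => /eqP.
rewrite gt_eqF // ltr_pwDl ?mulr_gt0 ?sqrt_deg_gt0 //.
by apply: sumr_ge0 => u _; rewrite mulr_ge0 // ltW ?sqrt_deg_gt0.
Qed.

Lemma eigen_center0 g : L *m g = lam *: g -> g v 0 = 0.
Proof.
move=> Lg; apply/le_anti; rewrite eigen_center_le0 //=.
have : L *m (- g) = lam *: (- g) by rewrite mulmxN Lg scalerN.
by move/eigen_center_le0; rewrite mxE oppr_le0.
Qed.

(** Since $\lambda_1 \le \mu(C) \le \mu(E)$ for every branch $E$, a branch
on which $g$ is not zero must have $\mu(E) = \lambda_1$, and the sign
properties of eigenvectors for $\mu(E)$ apply to $g$ there. *)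
Lemma perron_characteristic g : g != 0 -> L *m g = lam *: g ->
  type1 e g /\ is_characteristic_vertex e g v.
Proof.
move=> g0 Lg; have gv := eigen_center0 Lg.
have [CB minC] := perron_branchP _ CP.
have signE E u : E \in branches e v -> u \in E -> g u 0 != 0 ->
  (forall w, w \in E -> g w 0 != 0) /\
  (forall w w', w \in E -> w' \in E -> e w w' -> 0 <= g w 0 * g w' 0).
  move=> EB uE gu; have x0 : restr E g != 0.
    by apply: contra gu => /eqP gE; rewrite -(restrE g uE) gE mxE.
  have eq_lam : lam = bottom E.
    apply/le_anti; rewrite (le_trans lambda1_le_perron) ?minC //.
    exact: bottom_le_lambda1 Lg x0.
  have xE := restr_eigen EB gv Lg; rewrite [X in forall u, _ -> _ = X * _]eq_lam in xE.
  have [xn0 xs _] := perron_sign EB (@restr_supported E g) x0 xE.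
  split=> [w wE|w w' wE w'E ww']; first by rewrite -(restrE g wE) xn0.
  by rewrite -(restrE g wE) -(restrE g w'E) xs.
split.
  move=> u w uw mixed.
  have [gu gw guw] : [/\ g u 0 != 0, g w 0 != 0 & g u 0 * g w 0 < 0].
    case: mixed => [[u0 w0]|[u0 w0]].
      by rewrite gt_eqF // lt_eqF // pmulr_rlt0.
    by rewrite lt_eqF // gt_eqF // nmulr_rlt0.
  have neq_v t : g t 0 != 0 -> t != v by apply: contraNneq => ->; rewrite gv.
  have [E EB uE] := branch_cover (neq_v u gu).
  have wE := branch_neighbor EB uE uw (neq_v w gw).
  have [_ /(_ u w uE wE uw)] := signE E u EB uE gu.
  by rewrite leNgt guw.
split=> //.
have [u gu] : exists u, g u 0 != 0.
  apply/existsP; apply: contraR g0; rewrite negb_exists => /forallP gn0.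
  by apply/eqP/matrixP => u j; rewrite ord1 mxE; apply/eqP/negPn.
have uv : u != v by apply: contraNneq gu => ->; rewrite gv.
have [E EB uE] := branch_cover uv; have [w wE vw] := branch_root EB.
by exists w => //; have [-> ] := signE E u EB uE gu.
Qed.

End TwoPerron.

End Branches.
End Laplacian.

Theorem theorem6 (R : rcfType) (n : nat) (e : rel 'I_n) (g : 'cV[R]_n)
    (v : 'I_n) :
  (2 <= n)%N ->
  is_tree e ->
  is_eigenfunction (norm_laplacian R e) (lambda1 R e) g ->
  ((type1 e g /\ is_characteristic_vertex e g v) <->
     (2 <= #|perron_branches R e v|)%N) /\
  (type1 e g /\ is_characteristic_vertex e g v ->
     forall C : {set 'I_n}, C \in perron_branches R e v ->
       lambda1 R e = 1 / spectral_radius (bottleneck R e C)).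
Proof.
move=> n_gt1 treeE [g0 Lg]; split; first split.
- case=> _ /(characteristic_vertex_branches n_gt1 treeE Lg)[C [D [CP DP CD _]]].
  by apply/card_gt1P; exists C, D.
- case/card_gt1P => C [D [CP DP CD]].
  exact: (perron_characteristic n_gt1 treeE CP DP CD).
- case=> _ /(characteristic_vertex_branches n_gt1 treeE Lg)[_ [_ [_ _ _ eqP]]] C.
  by move/eqP <-; rewrite div1r.
Qed.
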